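(* Let $\phi$ be a cyclic formula with root $r$, and let $G$ be its set of $\Box$-occurrences. Assign to each $a\in G$ a variable $q_a$, pairwise distinct and not occurring in $\phi$, and let $\psi_a:={\sf E}_\phi(a)$. Then $\bigwedge_{a\in G}\boxdot^\bullet(q_a\leftrightarrow\Box\psi_{S_0a})\vdash_{\mathsf{CHL}}\psi_r\leftrightarrow\phi$.
   Context: Labels: $\bot,\top$ and propositional variables (arity 0), $\neg,\Box$ (arity 1), $\wedge,\vee,\to$ (arity 2). A graph is $\langle V,r,S,\lambda\rangle$ with $V$ finite, root $r$, labelling $\lambda$, $S:V\to V^{*}$ ordered successors (length = arity of label), $S_i(a)$ the $i$-th; every vertex reachable from $r$. A (cyclic) formula is a graph in which every cycle (closed path of pairwise distinct vertices along successors) contains a $\Box$-labelled vertex ($\Box$-occurrence). Bisimulation: $aRa'$ implies equal labels and $i$-th successors related; $\simeq$ = bisimilarity relating roots. $\digamma p.\chi$ (for $\chi$ modalised in $p$, i.e. every root-to-$p$ path passes a $\Box$-occurrence) identifies the root with all $p$-labelled vertices, keeping the root's label. ${\sf E}_\phi$ maps vertices of $\phi$ to acyclic (ordinary) modal formulas by recursion along successors with $\Box$-occurrences as base: ${\sf E}_\phi(a):=q_a$ if $a$ is a $\Box$-occurrence; ${\sf E}_\phi(a):=\$( {\sf E}_\phi(S_0a),\dots,{\sf E}_\phi(S_{n-1}a))$ if $a$ has any other label $\$$ of arity $n$ (a $p$-occurrence gives $p$). $\mathsf{CHL}$: least set of cyclic formulas containing all substitution instances of propositional tautologies, all $\Box(\phi\to\psi)\to(\Box\phi\to\Box\psi)$,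 all $\phi\leftrightarrow\psi$ with $\phi\simeq\psi$, closed under modus ponens, necessitation and Löb's rule (from $\vdash\Box\phi\to\phi$ infer $\vdash\phi$). $\Gamma\vdash_{\mathsf{CHL}}\phi$ means $\mathsf{CHL}\vdash\bigwedge\Gamma\to\phi$. $\Box^\bullet\chi:=\digamma p.\Box(\chi\wedge p)$ ($p$ not in $\chi$); $\boxdot^\bullet\chi:=\chi\wedge\Box^\bullet\chi$. *)

(* Defs.v *)
From mathcomp Require Import all_boot.

Set Implicit Arguments.
Unset Strict Implicit.
Unset Printing Implicit Defensive.

(* Propositional variables are natural numbers. *)
Inductive label : Type :=
  LBot | LTop | LVar of nat | LNot | LBox | LAnd | LOr | LImp.

Definition arity (l : label) : nat :=
  match l with
  | LBot | LTop | LVar _ => 0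
  | LNot | LBox => 1
  | LAnd | LOr | LImp => 2
  end.

Definition is_box (l : label) : bool := if l is LBox then true else false.

Definition is_var (p : nat) (l : label) : bool :=
  if l is LVar p' then p == p' else false.

Record graph : Type := Graph {
  vert :> finType;
  groot : vert;
  succs : vert -> seq vert;
  lab : vert -> label;
  size_succs : forall a, size (succs a) = arity (lab a);
  reachable : forall a, connect (grel succs) groot a }.

Arguments groot : clear implicits.

(* The default value of [nth] is irrelevant for [i < arity (lab a)]. *)
Definition succ (g : graph) (i : nat) (a : g) : g := nth a (succs a) i.

Definition guarded (V : finType) (S : V -> seq V) (l : V -> label) : Prop :=
  forall c : seq V, c != [::] -> cycle (grel S) c -> uniq c ->
    has (fun a => is_box (l a)) c.

Record cform : Type := CForm {
  cgraph :> graph;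
  cformP : guarded (@succs cgraph) (@lab cgraph) }.

Definition box_occ (g : graph) : pred g := fun a => is_box (lab a).

Definition occurs (p : nat) (g : graph) : bool :=
  [exists a : g, is_var p (lab a)].

Definition bisimulation (g h : graph) (R : g -> h -> Prop) : Prop :=
  forall a b, R a b ->
    lab a = lab b /\ (forall i, i < arity (lab a) -> R (succ i a) (succ i b)).

Definition bisimilar (g h : graph) : Prop :=
  exists2 R : g -> h -> Prop, bisimulation R & R (groot g) (groot h).

(* Guardedness is equivalent to the existence of a rank decreasing along the
   edges whose source is not a box-occurrence. *)
Section Rank.
Variables (V : finType) (S : V -> seq V) (l : V -> label).

Definition nbedge : rel V := fun a b => ~~ is_box (l a) && (b \in S a).
Definition rank (a : V) : nat := #|connect nbedge a|.

Lemma guarded_rank : guarded S l -> forall a b, nbedge a b -> rank b < rank a.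
Proof.
move=> gS a b ab; apply: proper_card; apply/properP; split.
  by apply/subsetP => c; apply: connect_trans; apply: connect1.
exists a; first exact: connect0.
apply/negP => /connectP[s0 s0P]; case/shortenP: s0P => s sP us _ lasts.
have cyc : cycle nbedge (b :: s) by rewrite /= rcons_path sP -lasts.
have sub : subrel nbedge (grel S) by move=> x y /andP[].
have := gS (b :: s) isT (sub_cycle sub cyc) us.
move=> /hasP[x xc bx]; have := next_cycle cyc xc.
by rewrite /nbedge bx.
Qed.

Lemma rank_guarded (r : V -> nat) :
  (forall a b, nbedge a b -> r b < r a) -> guarded S l.
Proof.
move=> rP [//|a s] _ cyc _; apply/negPn/negP => /hasPn nb.
have lt : forall x, x \in a :: s -> r (next (a :: s) x) < r x.
  by move=> x xc; apply: rP; rewrite /nbedge nb //; apply: next_cycle cyc xc.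
have [x xc xmin] : exists2 x, x \in a :: s & forall y, y \in a :: s -> r x <= r y.
  case: (arg_minnP (P := [in a :: s]) r (mem_head a s)) => x xc xm.
  by exists x.
have := lt x xc; rewrite ltnNge xmin // mem_next //.
Qed.
End Rank.

(* Formula-building operations: a fresh root above disjoint copies of the
   arguments. *)
Lemma connect_homo (T U : finType) (e : rel T) (e' : rel U) (f : T -> U) :
  (forall x y, e x y -> e' (f x) (f y)) ->
  forall x y, connect e x y -> connect e' (f x) (f y).
Proof.
move=> ef x y /connectP[s sP ->]; elim: s x sP => [|z s IH] x /=.
  by move=> _; apply: connect0.
by move=> /andP[xz zs]; apply: connect_trans (connect1 (ef _ _ xz)) (IH _ zs).
Qed.

Section Op0.
Variables (l : label) (l0 : arity l = 0).
Let succs0 (_ : unit) : seq unit := [::].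
Let lab0 (_ : unit) : label := l.

Fact op0_size a : size (succs0 a) = arity (lab0 a). Proof. by rewrite l0. Qed.
Fact op0_reach a : connect (grel succs0) tt a.
Proof. by case: a; apply: connect0. Qed.
Fact op0_guarded : guarded succs0 lab0.
Proof. by apply: (@rank_guarded _ _ _ (fun=> 0)) => a b /andP[]. Qed.

Definition op0 : cform := @CForm (Graph op0_size op0_reach) op0_guarded.
End Op0.

Section Op1.
Variables (l : label) (l1 : arity l = 1) (phi : cform).
Let V : finType := option phi.
Let succs1 (a : V) : seq V :=
  if a is Some b then map Some (succs b) else [:: Some (groot phi)].
Let lab1 (a : V) : label := if a is Some b then lab b else l.

Fact op1_size a : size (succs1 a) = arity (lab1 a).
Proof. by case: a => [a|] /=; rewrite ?size_map ?size_succs ?l1. Qed.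

Fact op1_reach a : connect (grel succs1) None a.
Proof.
case: a => [a|]; last exact: connect0.
apply: (@connect_trans _ _ (Some (groot phi))).
  by apply: connect1; rewrite /= inE.
apply: (connect_homo (e := grel (@succs phi))); last exact: reachable.
by move=> x y /= xy; apply: map_f.
Qed.

Fact op1_guarded : guarded succs1 lab1.
Proof.
pose rk := rank (@succs phi) (@lab phi).
apply: (@rank_guarded _ _ _ (fun a => if a is Some b then rk b else #|phi|.+1)).
move=> [a|] b /andP[/= nb].
  move=> /mapP[c ca ->]; apply: guarded_rank; first exact: cformP.
  by rewrite /nbedge nb.
by rewrite inE => /eqP->; rewrite ltnS max_card.
Qed.

Definition op1 : cform := @CForm (Graph op1_size op1_reach) op1_guarded.
End Op1.

Section Op2.
Variables (l : label) (l2 : arity l = 2) (phi psi : cform).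
Let V : finType := option (phi + psi)%type.
Let inj1 (a : phi) : V := Some (inl a).
Let inj2 (a : psi) : V := Some (inr a).
Let succs2 (a : V) : seq V :=
  match a with
  | None => [:: inj1 (groot phi); inj2 (groot psi)]
  | Some (inl b) => map inj1 (succs b)
  | Some (inr b) => map inj2 (succs b)
  end.
Let lab2 (a : V) : label :=
  match a with None => l | Some (inl b) => lab b | Some (inr b) => lab b end.

Fact op2_size a : size (succs2 a) = arity (lab2 a).
Proof. by case: a => [[a|a]|] /=; rewrite ?size_map ?size_succs ?l2. Qed.

Fact op2_reach a : connect (grel succs2) None a.
Proof.
case: a => [[a|a]|]; last exact: connect0.
- apply: (@connect_trans _ _ (inj1 (groot phi))).
    by apply: connect1; rewrite /= !inE eqxx.
  apply: (connect_homo (f := inj1) _ (reachable a)).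
  by move=> x y /= xy; apply: map_f.
- apply: (@connect_trans _ _ (inj2 (groot psi))).
    by apply: connect1; rewrite /= !inE eqxx orbT.
  apply: (connect_homo (f := inj2) _ (reachable a)).
  by move=> x y /= xy; apply: map_f.
Qed.

Fact op2_guarded : guarded succs2 lab2.
Proof.
pose rk1 := rank (@succs phi) (@lab phi).
pose rk2 := rank (@succs psi) (@lab psi).
apply: (@rank_guarded _ _ _ (fun a => match a with
  | Some (inl b) => rk1 b | Some (inr b) => rk2 b
  | None => (#|phi| + #|psi|).+1 end)).
move=> [[a|a]|] b /andP[/= nb].
- move=> /mapP[c ca ->]; apply: guarded_rank; first exact: cformP.
  by rewrite /nbedge nb.
- move=> /mapP[c ca ->]; apply: guarded_rank; first exact: cformP.
  by rewrite /nbedge nb.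
rewrite !inE => /orP[]/eqP->; rewrite ltnS.
  exact: leq_trans (max_card _) (leq_addr _ _).
exact: leq_trans (max_card _) (leq_addl _ _).
Qed.

Definition op2 : cform := @CForm (Graph op2_size op2_reach) op2_guarded.
End Op2.

Definition cbot : cform := @op0 LBot erefl.
Definition ctop : cform := @op0 LTop erefl.
Definition cvar (p : nat) : cform := @op0 (LVar p) erefl.
Definition cnot : cform -> cform := @op1 LNot erefl.
Definition cbox : cform -> cform := @op1 LBox erefl.
Definition cand : cform -> cform -> cform := @op2 LAnd erefl.
Definition cor : cform -> cform -> cform := @op2 LOr erefl.
Definition cimp : cform -> cform -> cform := @op2 LImp erefl.
Definition ciff (phi psi : cform) : cform := cand (cimp phi psi) (cimp psi phi).
Definition bigand (Gamma : seq cform) : cform := foldr cand ctop Gamma.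

Definition modalised (p : nat) (chi : cform) : Prop :=
  forall s : seq chi, path (grel (@succs chi)) (groot chi) s ->
    is_var p (lab (last (groot chi) s)) ->
    has (@box_occ chi) (groot chi :: s).

(* The fixed point operator: the [p]-labelled vertices are removed and every
   edge into one of them is redirected to the root. *)
Section FixOp.
Variables (p : nat) (chi : cform) (chiP : modalised p chi).
Let V : finType := {a : chi | ~~ is_var p (lab a)}.

Fact cfix_root : ~~ is_var p (lab (groot chi)).
Proof.
apply/negP => rp; have := chiP (s := [::]) isT rp.
by move: rp; rewrite /= /box_occ; case: (lab _).
Qed.

Let root' : V := exist _ (groot chi) cfix_root.
(* Sends [p]-labelled vertices to [root'], and is the identity elsewhere. *)
Let redirect (a : chi) : V := insubd root' a.
Let succs' (a : V) : seq V := map redirect (succs (val a)).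
Let lab' (a : V) : label := lab (val a).

Fact cfix_size a : size (succs' a) = arity (lab' a).
Proof. by rewrite size_map size_succs. Qed.

Fact cfix_reach a : connect (grel succs') root' a.
Proof.
suff H s x : connect (grel succs') root' (redirect x) ->
    path (grel (@succs chi)) x s ->
    connect (grel succs') root' (redirect (last x s)).
  have /connectP[s sP Da] := reachable (val a).
  have -> : a = redirect (val a) by rewrite /redirect valKd.
  rewrite Da; apply: H sP.
  by have -> : redirect (groot chi) = root' by apply: (valKd root' root').
elim: s x => [|y s IH] x //= rx /andP[xy ys].
apply: IH ys; have [yp|yp] := boolP (is_var p (lab y)).
  rewrite /redirect /insubd insubN ?yp //; exact: connect0.
apply: connect_trans rx (connect1 _) => /=.
have nx : ~~ is_var p (lab x).
  by apply/negP; move: (size_succs x) xy; case: (lab x) => // n /size0nil->.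
by apply/map_f; rewrite /redirect insubdK.
Qed.

Fact cfix_guarded : guarded succs' lab'.
Proof.
pose nb := nbedge (@succs chi) (@lab chi).
pose rk := rank (@succs chi) (@lab chi).
pose rd := connect nb (groot chi).
apply: (@rank_guarded _ _ _
  (fun a => if rd (val a) then rk (val a) else #|chi|.+1 + rk (val a))).
move=> a b /andP[nba /mapP[c ca ->{b}]].
have nbac : nb (val a) c by apply/andP.
have rkac : rk c < rk (val a) by apply: guarded_rank nbac; apply: cformP.
rewrite /redirect val_insubd; have [cp|] := boolP (~~ is_var p (lab c)).
  case: ifPn => rc; case: ifPn => ra.
  - by [].
  - exact: ltn_addl.
  - by case/negP: rc; exact: (connect_trans ra (connect1 nbac)).
  - by rewrite ltn_add2l.
rewrite negbK => cp.
have -> : rd (val root') = true by apply: connect0.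
case: ifPn => ra; last by rewrite addSn ltnS (leq_trans (max_card _)) ?leq_addr.
have /connectP[s sP cs] : rd c by exact: (connect_trans ra (connect1 nbac)).
have sP' : path (grel (@succs chi)) (groot chi) s.
  by apply: sub_path sP => x y /andP[].
have := chiP sP'; rewrite -cs => /(_ cp) bx; exfalso.
have nbc : ~~ box_occ c by move: cp; rewrite /box_occ; case: (lab c).
move: sP bx cs; elim: s (groot chi) {sP'} => [|y s IH] x /=.
  by move=> _; rewrite orbF => bx cx; rewrite cx bx in nbc.
by move=> /andP[/andP[nx _] ys] /orP[bx|bs cs];
  [rewrite /box_occ (negPf nx) in bx | exact: (IH y ys bs cs)].
Qed.

Definition cfix : cform := @CForm (Graph cfix_size cfix_reach) cfix_guarded.
End FixOp.

Definition fresh (g : graph) : nat :=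
  (\max_(a : g) if lab a is LVar p then p else 0).+1.

Fact freshP (g : graph) : ~~ occurs (fresh g) g.
Proof.
apply/existsPn => a; apply/negP => ha.
have := leq_bigmax (F := fun a : g => if lab a is LVar p then p else 0) a.
by move: ha; case: (lab a) => //= p /eqP <-; rewrite /fresh ltnn.
Qed.

Fact modalised_box (p : nat) (chi : cform) : modalised p (cbox chi).
Proof. by move=> s _ _. Qed.

(* Up to isomorphism, the result does not depend on the variable chosen. *)
Definition boxinf (chi : cform) : cform :=
  cfix (modalised_box (p := fresh chi) (chi := cand chi (cvar (fresh chi)))).

Definition boxdotinf (chi : cform) : cform := cand chi (boxinf chi).

(* Ordinary modal formulas. *)
Inductive mform : Type :=
  MBot | MTop | MVar of nat | MNot of mform | MBox of mform
| MAnd of mform & mform | MOr of mform & mform | MImp of mform & mform.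

Fixpoint subst (s : nat -> cform) (A : mform) : cform :=
  match A with
  | MBot => cbot
  | MTop => ctop
  | MVar p => s p
  | MNot B => cnot (subst s B)
  | MBox B => cbox (subst s B)
  | MAnd B C => cand (subst s B) (subst s C)
  | MOr B C => cor (subst s B) (subst s C)
  | MImp B C => cimp (subst s B) (subst s C)
  end.

Definition embed : mform -> cform := subst cvar.

Fixpoint box_free (A : mform) : bool :=
  match A with
  | MBot | MTop | MVar _ => true
  | MNot B => box_free B
  | MBox _ => false
  | MAnd B C | MOr B C | MImp B C => box_free B && box_free C
  end.

(* Only meaningful on box-free formulas. *)
Fixpoint eval (v : nat -> bool) (A : mform) : bool :=
  match A with
  | MBot => false
  | MTop => true
  | MVar p => v p
  | MNot B => ~~ eval v B
  | MBox _ => false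
  | MAnd B C => eval v B && eval v C
  | MOr B C => eval v B || eval v C
  | MImp B C => eval v B ==> eval v C
  end.

Definition tautology (A : mform) : Prop := box_free A /\ forall v, eval v A.

Inductive CHL : cform -> Prop :=
| CHL_taut A s : tautology A -> CHL (subst s A)
| CHL_K phi psi :
    CHL (cimp (cbox (cimp phi psi)) (cimp (cbox phi) (cbox psi)))
| CHL_bisim (phi psi : cform) : bisimilar phi psi -> CHL (ciff phi psi)
| CHL_mp phi psi : CHL (cimp phi psi) -> CHL phi -> CHL psi
| CHL_nec phi : CHL phi -> CHL (cbox phi)
| CHL_loeb phi : CHL (cimp (cbox phi) phi) -> CHL phi.

Definition CHL_derives (Gamma : seq cform) (phi : cform) : Prop :=
  CHL (cimp (bigand Gamma) phi).

Section Unfolding.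
Variables (phi : cform) (q : phi -> nat).

Definition E_step (f : phi -> mform) (a : phi) : mform :=
  match lab a with
  | LBox => MVar (q a)
  | LBot => MBot
  | LTop => MTop
  | LVar p => MVar p
  | LNot => MNot (f (succ 0 a))
  | LAnd => MAnd (f (succ 0 a)) (f (succ 1 a))
  | LOr => MOr (f (succ 0 a)) (f (succ 1 a))
  | LImp => MImp (f (succ 0 a)) (f (succ 1 a))
  end.

(* By guardedness the recursion bottoms out within [#|phi|] steps, so that the
   initial value is never used: see [E_eq]. *)
Definition E : phi -> mform := iter #|phi| E_step (fun=> MBot).

Lemma E_stable n f g a : rank (@succs phi) (@lab phi) a <= n ->
  iter n E_step f a = iter n E_step g a.
Proof.
elim: n a => [|n IH] a.
  by rewrite leqNgt => /negP[]; apply/card_gt0P; exists a; apply: connect0.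
move=> ra; rewrite !iterS /E_step.
have H i : ~~ is_box (lab a) -> i < arity (lab a) ->
    iter n E_step f (succ i a) = iter n E_step g (succ i a).
  move=> nb ia; apply: IH; rewrite -ltnS; apply: leq_trans ra.
  apply: guarded_rank; first exact: cformP.
  by rewrite /nbedge nb mem_nth // size_succs.
by case: (lab a) H => //= H; rewrite !H.
Qed.

Lemma E_eq a : E a = E_step E a.
Proof.
rewrite /E -iterS iterSr; apply: E_stable; exact: max_card.
Qed.
End Unfolding.

(* Main.v *)
(** Let [phi_b] be the formula generated by the vertex [b] of [phi], and [Delta]
    the conjunction of all [q_a <-> phi_a] for [a] a box-occurrence. By induction
    along the edges leaving non-boxes, [Delta] derives [psi_b <-> phi_b] for every
    vertex [b]. Hence [Box Delta] derives [Box psi_{S_0 a} <-> phi_a], and together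
    with the hypotheses [Gamma] it derives [Delta]. Since [Gamma] derives
    [Box Gamma] (as [boxinf chi] is bisimilar to [Box (boxdotinf chi)]), Löb's rule
    applied to [Gamma -> Delta] gives [Gamma |- Delta]; conclude with [b] the root. *)

Require Import Defs.
From mathcomp Require Import all_boot.

(** * Bisimilarities *)

Definition graph_hom (g h : graph) (f : g -> h) : Prop :=
  forall a, lab (f a) = lab a /\ succs (f a) = map f (succs a).

Lemma graph_hom_succ {g h : graph} {f : g -> h} : graph_hom g h f ->
  forall a i, i < arity (lab a) -> f (succ i a) = succ i (f a).
Proof.
move=> fP a i ia; have [_ fS] := fP a.
by rewrite /succ fS (nth_map a) // size_succs.
Qed.

(** The relation [f x = f' y] is a bisimulation, because homomorphisms preserve labels and ordered
    successors. All bisimilarities below come from such a pair of maps into a common graph. *)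
Lemma bisimilar_hom {g h u : graph} (f : g -> u) (f' : h -> u) :
  graph_hom g u f -> graph_hom h u f' -> f (groot g) = f' (groot h) ->
  bisimilar g h.
Proof.
move=> fP f'P froot; exists (fun x y => f x = f' y) => // a b fab.
have lab_ab : lab a = lab b by have [<- _] := fP a; rewrite fab; case: (f'P b).
split=> // i ia; rewrite (graph_hom_succ fP) // fab (graph_hom_succ f'P) //.
by rewrite -lab_ab.
Qed.

Lemma graph_hom_id (g : graph) : graph_hom g g id.
Proof. by move=> a; rewrite map_id. Qed.

(** * The formula generated by a vertex *)

Section Generated.
Variables (phi : cform) (a : phi).

Definition gen_vert : finType := {x : phi | connect (grel (@succs phi)) a x}.
Definition gen_root : gen_vert := exist _ a (connect0 _ a).
(** The default [gen_root] of [insubd] is never taken: successors of a vertex reachable from [a] are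
    reachable from [a]. *)
Definition gen_succs (x : gen_vert) : seq gen_vert :=
  map (insubd gen_root) (succs (val x)).
Definition gen_lab (x : gen_vert) : label := lab (val x).

Lemma val_gen_succs x : map val (gen_succs x) = succs (val x).
Proof.
rewrite /gen_succs -map_comp -[RHS]map_id; apply/eq_in_map => y xy /=.
by apply: insubdK; apply: connect_trans (valP x) (connect1 _).
Qed.

Fact gen_size x : size (gen_succs x) = arity (gen_lab x).
Proof. by rewrite size_map size_succs. Qed.

Fact gen_reach x : connect (grel gen_succs) gen_root x.
Proof.
case: x => x ax; case/connectP: (ax) => s.
(* Induction from the end of the path keeps its source at [a], so every prefix again ends in a
   vertex of the generated graph. *)
elim/last_ind: s x ax => [|s y IH] x ax /=.
  by move=> _ Dx; rewrite (_ : exist _ _ _ = gen_root) //; apply: val_inj.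
rewrite rcons_path last_rcons => /andP[sP sy] Dx; subst x.
have al : connect (grel (@succs phi)) a (last a s) by apply/connectP; exists s.
apply: connect_trans (IH _ al sP erefl) (connect1 _).
by rewrite /= -(mem_map val_inj) val_gen_succs.
Qed.

Fact gen_guarded : guarded gen_succs gen_lab.
Proof.
apply: (@rank_guarded _ _ _ (fun x => rank (@succs phi) (@lab phi) (val x))).
move=> x y /andP[bx]; rewrite -(mem_map val_inj) val_gen_succs => xy.
by apply: guarded_rank; [exact: cformP | rewrite /nbedge bx].
Qed.

Definition gen : cform :=
  @CForm (@Graph _ gen_root _ _ gen_size gen_reach) gen_guarded.

Lemma gen_hom : graph_hom gen phi val.
Proof. by move=> x; split=> //; rewrite -val_gen_succs. Qed.
End Generated.
Arguments gen {phi}.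

Section GeneratedUnfold.
Variable phi : cform.
Implicit Type a : phi.

Lemma gen_root_bisim : bisimilar (gen (groot phi)) phi.
Proof. exact: bisimilar_hom (gen_hom phi _) (graph_hom_id phi) erefl. Qed.

Lemma succs_arity0 a : arity (lab a) = 0 -> succs a = [::].
Proof. by move=> la; apply: size0nil; rewrite size_succs. Qed.

Lemma succs_arity1 a : arity (lab a) = 1 -> succs a = [:: succ 0 a].
Proof. by rewrite /succ -size_succs; case: (succs a) => [|x [|]]. Qed.

Lemma succs_arity2 a :
  arity (lab a) = 2 -> succs a = [:: succ 0 a; succ 1 a].
Proof. by rewrite /succ -size_succs; case: (succs a) => [|x [|y [|]]]. Qed.

(** Here and in the next two lemmas both sides map into [phi]: the fresh root goes to [a], and
    copies of generated formulas go in by inclusion. If [a] lies on a cycle it also occurs in such a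
    copy, so the two sides are bisimilar without being isomorphic. *)
Lemma gen_op0 a l (l0 : arity l = 0) :
  lab a = l -> bisimilar (op0 l0) (gen a).
Proof.
move=> la; refine (bisimilar_hom (g := op0 l0) (u := phi)
  (fun=> a) _ _ (gen_hom phi a) erefl) => x.
by split=> //=; rewrite succs_arity0 ?la.
Qed.

Lemma gen_op1 a l (l1 : arity l = 1) :
  lab a = l -> bisimilar (op1 l1 (gen (succ 0 a))) (gen a).
Proof.
move=> la; refine (bisimilar_hom (g := op1 l1 (gen (succ 0 a))) (u := phi)
  (fun x => if x is Some y then val y else a) _ _ (gen_hom phi a) erefl).
case=> [x|]; split=> //=; last by rewrite succs_arity1 ?la.
by rewrite -map_comp -val_gen_succs.
Qed.

Lemma gen_op2 a l (l2 : arity l = 2) :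
  lab a = l -> bisimilar (op2 l2 (gen (succ 0 a)) (gen (succ 1 a))) (gen a).
Proof.
move=> la; refine (bisimilar_hom
  (g := op2 l2 (gen (succ 0 a)) (gen (succ 1 a))) (u := phi)
  (fun x => match x with
            | None => a | Some (inl y) => val y | Some (inr y) => val y
            end) _ _ (gen_hom phi a) erefl).
case=> [[x|x]|]; split=> //=; last by rewrite succs_arity2 ?la.
  by rewrite -map_comp -val_gen_succs.
by rewrite -map_comp -val_gen_succs.
Qed.
End GeneratedUnfold.

(** * Unfolding the fixed point once *)

Section BoxinfUnfold.
Variable chi : cform.
Let p := fresh chi.
Let body := cbox (cand chi (cvar p)).

(** The unfolding contains [chi] twice, once outright and once inside [boxinf chi]; both copies land
    on the single copy in [body]. *)
Let collapse (x : cbox (boxdotinf chi)) : body :=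
  match x with
  | None => None
  | Some None => Some None
  | Some (Some (inl y)) => Some (Some (inl y))
  | Some (Some (inr y)) => val y
  end.

(** The default is never taken here: no value of [collapse] is labelled [p], as [p] is fresh for
    [chi]. *)
Let fold (x : cbox (boxdotinf chi)) : boxinf chi :=
  insubd (groot (boxinf chi)) (collapse x).

Let val_fold x : val (fold x) = collapse x.
Proof.
apply: insubdK; case: x => [[[y|y]|]|] //=; last exact: (valP y).
by have /existsPn/(_ y) := freshP chi.
Qed.

Lemma boxinf_unfold : bisimilar (boxinf chi) (cbox (boxdotinf chi)).
Proof.
apply: (@bisimilar_hom _ _ (boxinf chi) id fold); first exact: graph_hom_id.
  move=> x; split.
    rewrite [LHS](_ : _ = lab (collapse x)); last by rewrite -val_fold.
    by case: x => [[[y|y]|]|].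
  rewrite [LHS](_ : _ = map (insubd (groot (boxinf chi))) (succs (collapse x)));
    last by rewrite -val_fold.
  case: x => [[[y|y]|]|] //=.
  - by rewrite -!map_comp.
  - by rewrite -!map_comp /=; apply: eq_map => z; rewrite /fold /= valKd.
  (* Here the default of [insubd] does matter: the second conjunct in [body] is the [p]-leaf,
     redirected to the root, and the root of the inner [boxinf chi] is folded onto that same
     root. *)
  - by congr [:: _; _]; apply: val_inj; rewrite val_fold val_insubd /= eqxx.
by apply: val_inj; rewrite val_fold.
Qed.
End BoxinfUnfold.

(** * Derived rules *)

(** Repeated modus ponens turns a tautology [A1 -> ... -> An -> B] into a rule. For concrete [As]
    the fold computes to a chain of implications, ready for [apply]. Below, [s] is an [nth], so that
    [MVar i] stands for the [i]-th listed formula, and boxed formulas can be listed as atoms. *)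
Lemma CHL_taut_rule (s : nat -> cform) (As : seq mform) (B : mform) :
  tautology (foldr MImp B As) ->
  foldr (fun A P => CHL (subst s A) -> P) (CHL (subst s B)) As.
Proof.
move=> /(CHL_taut s); elim: As => [//|A As IH] /= H sA.
by apply: IH; exact: CHL_mp H sA.
Qed.

Ltac decide_tautology :=
  let v := fresh "v" in
  split=> [//|v] /=;
  repeat match goal with |- context [v ?n] => case: (v n) end; done.

Lemma cimp_trans {a b c} : CHL (cimp a b) -> CHL (cimp b c) -> CHL (cimp a c).
Proof.
apply: (CHL_taut_rule (nth cbot [:: a; b; c])
  [:: MImp (MVar 0) (MVar 1); MImp (MVar 1) (MVar 2)] (MImp (MVar 0) (MVar 2))).
decide_tautology.
Qed.

Lemma cimp_const {d a} : CHL a -> CHL (cimp d a).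
Proof.
apply: (CHL_taut_rule (nth cbot [:: d; a])
  [:: MVar 1] (MImp (MVar 0) (MVar 1))).
decide_tautology.
Qed.

Lemma cimp_and {d a b} :
  CHL (cimp d a) -> CHL (cimp d b) -> CHL (cimp d (cand a b)).
Proof.
apply: (CHL_taut_rule (nth cbot [:: d; a; b])
  [:: MImp (MVar 0) (MVar 1); MImp (MVar 0) (MVar 2)]
  (MImp (MVar 0) (MAnd (MVar 1) (MVar 2)))).
decide_tautology.
Qed.

Lemma cand_projl a b : CHL (cimp (cand a b) a).
Proof.
apply: (CHL_taut_rule (nth cbot [:: a; b]) [::]
  (MImp (MAnd (MVar 0) (MVar 1)) (MVar 0))).
decide_tautology.
Qed.

Lemma cand_projr a b : CHL (cimp (cand a b) b).
Proof.
apply: (CHL_taut_rule (nth cbot [:: a; b]) [::]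
  (MImp (MAnd (MVar 0) (MVar 1)) (MVar 1))).
decide_tautology.
Qed.

Definition miff (A B : mform) : mform := MAnd (MImp A B) (MImp B A).

Lemma ciff_trans {d a b c} :
  CHL (cimp d (ciff a b)) -> CHL (cimp d (ciff b c)) -> CHL (cimp d (ciff a c)).
Proof.
apply: (CHL_taut_rule (nth cbot [:: d; a; b; c])
  [:: MImp (MVar 0) (miff (MVar 1) (MVar 2));
      MImp (MVar 0) (miff (MVar 2) (MVar 3))]
  (MImp (MVar 0) (miff (MVar 1) (MVar 3)))).
decide_tautology.
Qed.

Lemma ciff_not {d a b} :
  CHL (cimp d (ciff a b)) -> CHL (cimp d (ciff (cnot a) (cnot b))).
Proof.
apply: (CHL_taut_rule (nth cbot [:: d; a; b])
  [:: MImp (MVar 0) (miff (MVar 1) (MVar 2))]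
  (MImp (MVar 0) (miff (MNot (MVar 1)) (MNot (MVar 2))))).
decide_tautology.
Qed.

Lemma ciff_op2 (M : mform -> mform -> mform) d a b a' b' :
  tautology (foldr MImp
    (MImp (MVar 0) (miff (M (MVar 1) (MVar 3)) (M (MVar 2) (MVar 4))))
    [:: MImp (MVar 0) (miff (MVar 1) (MVar 2));
        MImp (MVar 0) (miff (MVar 3) (MVar 4))]) ->
  let s := nth cbot [:: d; a; b; a'; b'] in
  CHL (cimp d (ciff a b)) -> CHL (cimp d (ciff a' b')) ->
  CHL (cimp d (ciff (subst s (M (MVar 1) (MVar 3)))
                    (subst s (M (MVar 2) (MVar 4))))).
Proof. by move=> taut s; apply: (CHL_taut_rule s _ _ taut). Qed.

Lemma ciff_and {d a b a' b'} :
  CHL (cimp d (ciff a b)) -> CHL (cimp d (ciff a' b')) ->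
  CHL (cimp d (ciff (cand a a') (cand b b'))).
Proof. apply: (ciff_op2 MAnd); decide_tautology. Qed.

Lemma ciff_or {d a b a' b'} :
  CHL (cimp d (ciff a b)) -> CHL (cimp d (ciff a' b')) ->
  CHL (cimp d (ciff (cor a a') (cor b b'))).
Proof. apply: (ciff_op2 MOr); decide_tautology. Qed.

Lemma ciff_imp {d a b a' b'} :
  CHL (cimp d (ciff a b)) -> CHL (cimp d (ciff a' b')) ->
  CHL (cimp d (ciff (cimp a a') (cimp b b'))).
Proof. apply: (ciff_op2 MImp); decide_tautology. Qed.

(** * Modal rules *)

Lemma cbox_mono {a b} : CHL (cimp a b) -> CHL (cimp (cbox a) (cbox b)).
Proof. by move=> /CHL_nec; apply: CHL_mp; exact: CHL_K. Qed.

Lemma cbox_and a b : CHL (cimp (cand (cbox a) (cbox b)) (cbox (cand a b))).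
Proof.
have /cbox_mono Ha : CHL (cimp a (cimp b (cand a b))).
  apply: (CHL_taut_rule (nth cbot [:: a; b]) [::]
    (MImp (MVar 0) (MImp (MVar 1) (MAnd (MVar 0) (MVar 1))))).
  decide_tautology.
move: (cimp_trans Ha (CHL_K _ _)).
apply: (CHL_taut_rule (nth cbot [:: cbox a; cbox b; cbox (cand a b)])
  [:: MImp (MVar 0) (MImp (MVar 1) (MVar 2))]
  (MImp (MAnd (MVar 0) (MVar 1)) (MVar 2))).
decide_tautology.
Qed.

(** Replacement under a box has a price: the hypothesis [d] becomes [cbox d]. *)
Lemma ciff_box {d a b} : CHL (cimp d (ciff a b)) ->
  CHL (cimp (cbox d) (ciff (cbox a) (cbox b))).
Proof.
move=> dab; apply: cimp_and; apply: cimp_trans (CHL_K _ _); apply: cbox_mono.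
  exact: cimp_trans dab (cand_projl _ _).
exact: cimp_trans dab (cand_projr _ _).
Qed.

(** Löb's rule for [cimp g d]: by K, [cbox (cimp g d)] and [cbox g] give [cbox d], and [g] itself
    supplies [cbox g]. *)
Lemma loeb_under g d : CHL (cimp g (cbox g)) ->
  CHL (cimp (cand g (cbox d)) d) -> CHL (cimp g d).
Proof.
move=> gg gdd; apply: CHL_loeb.
have gd : CHL (cimp (cbox (cimp g d)) (cimp (cbox g) (cbox d))) by exact: CHL_K.
move: gd gg gdd.
apply: (CHL_taut_rule (nth cbot [:: cbox (cimp g d); cbox g; cbox d; g; d])
  [:: MImp (MVar 0) (MImp (MVar 1) (MVar 2)); MImp (MVar 3) (MVar 1);
      MImp (MAnd (MVar 3) (MVar 2)) (MVar 4)]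
  (MImp (MVar 0) (MImp (MVar 3) (MVar 4)))).
decide_tautology.
Qed.

Section Bigand.
Variables (T : eqType) (f : T -> cform).

Lemma bigand_proj (s : seq T) x :
  x \in s -> CHL (cimp (bigand (map f s)) (f x)).
Proof.
elim: s => //= y s IH; rewrite inE => /predU1P[->|xs].
  exact: cand_projl.
exact: cimp_trans (cand_projr _ _) (IH xs).
Qed.

Lemma cimp_bigand d (s : seq T) :
  {in s, forall x, CHL (cimp d (f x))} -> CHL (cimp d (bigand (map f s))).
Proof.
elim: s => [_|y s IH H] /=.
  by apply: cimp_const; apply: (CHL_taut (fun=> cbot) (A := MTop)).
apply: cimp_and; first by apply: H; rewrite mem_head.
by apply: IH => x xs; apply: H; rewrite inE xs orbT.
Qed.

Lemma bigand_box (s : seq T) :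
  {in s, forall x, CHL (cimp (f x) (cbox (f x)))} ->
  CHL (cimp (bigand (map f s)) (cbox (bigand (map f s)))).
Proof.
elim: s => [_|y s IH H] /=.
  by apply/cimp_const/CHL_nec; apply: (CHL_taut (fun=> cbot) (A := MTop)).
apply: cimp_trans (cbox_and _ _); apply: cimp_and.
  by apply: cimp_trans (cand_projl _ _) (H _ _); rewrite mem_head.
apply: cimp_trans (cand_projr _ _) (IH _) => x xs.
by apply: H; rewrite inE xs orbT.
Qed.
End Bigand.

(** The second conjunct [boxinf chi] already unfolds to the conclusion. *)
Lemma boxdotinf_box chi : CHL (cimp (boxdotinf chi) (cbox (boxdotinf chi))).
Proof.
apply: cimp_trans (cand_projr _ _) _.
exact: CHL_mp (cand_projl _ _) (CHL_bisim (boxinf_unfold chi)).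
Qed.

(** * Solving the system of equations *)

Section Solution.
Variables (phi : cform) (q : phi -> nat).

Let delta : cform :=
  bigand [seq ciff (cvar (q a)) (gen a) | a in @box_occ phi].

(** At a box-occurrence the claim is a conjunct of [delta]. Elsewhere the outer connective respects
    equivalence, and [gen a] is bisimilar to that connective applied to the formulas generated by
    the successors. No box is crossed, so [delta] is needed only unboxed. *)
Lemma E_gen a : CHL (cimp delta (ciff (embed (E q a)) (gen a))).
Proof.
have [n] := ubnP (rank (@succs phi) (@lab phi) a); elim: n a => // n IH a.
rewrite ltnS => ran; have {IH}IH i : ~~ is_box (lab a) -> i < arity (lab a) ->
    CHL (cimp delta (ciff (embed (E q (succ i a))) (gen (succ i a)))).
  move=> nba ia; apply: IH; apply: leq_trans ran.
  apply: guarded_rank; first exact: cformP.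
  by rewrite /nbedge nba mem_nth // size_succs.
rewrite E_eq /E_step; case la: (lab a) IH => [||p|||||] IH.
- by apply/cimp_const/CHL_bisim/gen_op0.
- by apply/cimp_const/CHL_bisim/gen_op0.
- by apply/cimp_const/CHL_bisim/gen_op0.
- apply: ciff_trans (ciff_not (IH 0 _ _)) _ => //.
  by apply/cimp_const/CHL_bisim/gen_op1.
- by apply: bigand_proj; rewrite mem_enum unfold_in /box_occ la.
- apply: ciff_trans (ciff_and (IH 0 _ _) (IH 1 _ _)) _ => //.
  by apply/cimp_const/CHL_bisim/gen_op2.
- apply: ciff_trans (ciff_or (IH 0 _ _) (IH 1 _ _)) _ => //.
  by apply/cimp_const/CHL_bisim/gen_op2.
- apply: ciff_trans (ciff_imp (IH 0 _ _) (IH 1 _ _)) _ => //.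
  by apply/cimp_const/CHL_bisim/gen_op2.
Qed.

Let gamma : cform := bigand
  [seq boxdotinf (ciff (cvar (q a)) (cbox (embed (E q (succ 0 a)))))
    | a in @box_occ phi].

Lemma hypotheses_imp_gen : CHL (cimp gamma delta).
Proof.
apply: loeb_under; first by apply: bigand_box => a _; exact: boxdotinf_box.
apply: cimp_bigand => a; rewrite mem_enum => box_a.
have la : lab a = LBox
  by move: box_a; rewrite unfold_in /box_occ; case: (lab a).
have gamma_q : CHL (cimp gamma (ciff (cvar (q a))
    (cbox (embed (E q (succ 0 a)))))).
  by apply: cimp_trans (cand_projl _ _); apply: bigand_proj; rewrite mem_enum.
apply: ciff_trans (cimp_trans (cand_projl _ _) gamma_q) _.
(* As [a] is a box-occurrence, [gen a] is bisimilar to this boxed formula. What remains is a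
   replacement under the box, for which the assumption [cbox delta] from [loeb_under] suffices. *)
apply: (ciff_trans (b := cbox (gen (succ 0 a)))); last first.
  by apply/cimp_const/CHL_bisim/gen_op1.
exact: cimp_trans (cand_projr _ _) (ciff_box (E_gen _)).
Qed.
End Solution.

Theorem theorem3p10 (phi : cform) (q : phi -> nat)
    (q_inj : {in @box_occ phi &, injective q})
    (q_notin : {in @box_occ phi, forall a, ~~ occurs (q a) phi}) :
  let psi := E q in
  CHL_derives
    [seq boxdotinf (ciff (cvar (q a)) (cbox (embed (psi (succ 0 a)))))
      | a in @box_occ phi]
    (ciff (embed (psi (groot phi))) phi).
Proof.
move=> psi; apply: cimp_trans (hypotheses_imp_gen phi q) _.
apply: ciff_trans (E_gen phi q _) _.
exact: cimp_const (CHL_bisim (gen_root_bisim phi)).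
Qed.
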